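(* Let $k$ be a positive integer. As $D\to\infty$, for every $k$-uniform $k$-simple hypergraph $\mathcal{H}$ with maximum degree at most $D$ and every edge $e\in E(\mathcal{H})$, $$b_{L(\mathcal{H}),\,kD}(e)\le 1-\frac{k-1}{2k^2}+\frac{(k-1)(k-2)}{6k^3\sqrt{k}}+o(1),$$ where, for fixed $k$, the $o(1)$ term depends only on $D$ and tends to $0$ as $D\to\infty$.
   Context: A hypergraph $\mathcal{H}$ consists of a vertex set $V(\mathcal{H})$ and a multiset $E(\mathcal{H})$ of edges, each a subset of $V(\mathcal{H})$ (repeated edges are allowed and copies count as distinct edges). It is $k$-uniform if every edge has size $k$, and $t$-simple if every two distinct edges intersect in at most $t$ vertices (so for a $k$-uniform hypergraph, being $k$-simple is no restriction). The degree of a vertex is the number of edges (with multiplicity) containing it. The line graph $L(\mathcal{H})$ is the simple graph whose vertices are the edges of $\mathcal{H}$ (with multiplicity), two distinct edges being adjacent iff they intersect. For a graph $G$ and $v\in V(G)$, let $P_G(v):=\binom{\deg_G(v)}{2}-|E(N_G(v))|$ be the number of non-adjacent (unordered) pairs of distinct vertices in $N_G(v)$, where $E(N_G(v))$ is the set of edges of $G$ with both ends in $N_G(v)$, and let $T_G(v)$ be the number of $3$-element subsets of $N_G(v)$ that are pairwise non-adjacent in $G$. For a number $M\ge\Delta(G)$, define $$b_{G,M}(v):=\frac{\deg_G(v)}{M}-\frac{P_G(v)}{M^2}+\frac{T_G(v)}{M^3}.$$ *)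

(* Defs.v *)
From HB Require Import structures.
From mathcomp Require Import all_boot all_order all_algebra.

Set Implicit Arguments.
Unset Strict Implicit.
Unset Printing Implicit Defensive.

Import Order.TTheory GRing.Theory Num.Theory.

Local Open Scope ring_scope.

Record sgraph := SGraph {
  vertex :> finType;
  adj : rel vertex;
  adj_sym : symmetric adj;
  adj_irrefl : irreflexive adj }.

Section SimpleGraph.
Variable G : sgraph.
Implicit Types (v : G) (A : {set G}).

Definition nbhd v : {set G} := [set u | adj v u].

Definition deg v : nat := #|nbhd v|.

Definition edges_in A : {set {set G}} :=
  [set [set x; y] | x in A, y in A & adj x y].

Definition pairwise_nonadj A : bool :=
  [forall x in A, forall y in A, (x != y) ==> ~~ adj x y].

(* Truncated subtraction is harmless here, see [nonadj_pairsE]. *)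
Definition nonadj_pairs v : nat := ('C(deg v, 2) - #|edges_in (nbhd v)|)%N.

Definition nonadj_triples v : nat :=
  #|[set A : {set G} | [&& A \subset nbhd v, #|A| == 3 & pairwise_nonadj A]]|.

Lemma nonadj_pairsE v :
  nonadj_pairs v =
  #|[set A : {set G} | [&& A \subset nbhd v, #|A| == 2 & pairwise_nonadj A]]|.
Proof.
rewrite /nonadj_pairs /deg -cards_draws -cardsDS; last first.
  apply/subsetP => _ /imset2P[x y xN /[!inE] /andP[yN xy] ->].
  rewrite subUset !sub1set !inE in xN yN *; rewrite xN yN cards2 /=.
  by have [xy0|//] := eqVneq x y; rewrite xy0 adj_irrefl in xy.
apply: eq_card => A; rewrite !inE andbC -andbA.
apply: andb_id2l => AN; apply: andb_id2l => /cards2P[x [y [xy AE]]].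
have [xN yN] : x \in nbhd v /\ y \in nbhd v.
  by rewrite !(subsetP AN) // AE !inE eqxx ?orbT.
apply/idP/idP => [An|/forall_inP An].
  apply/forall_inP => z zA; apply/forall_inP => w wA; apply/implyP => zw.
  apply: contra An => zwadj; apply/imset2P; exists z w.
  - exact: (subsetP AN).
  - by rewrite inE (subsetP AN).
  - move: zA wA zw; rewrite AE !inE => /orP[]/eqP-> /orP[]/eqP->;
      by rewrite ?eqxx // setUC.
apply/negP => /imset2P[z w zN /[!inE] /andP[wN zw] Azw].
have zA : z \in A by rewrite Azw !inE eqxx.
have wA : w \in A by rewrite Azw !inE eqxx orbT.
have /forall_inP/(_ w wA) := An z zA; rewrite zw implybF negbK => /eqP zE.
by rewrite zE adj_irrefl in zw.
Qed.

Definition bfun (R : numFieldType) (M : R) v : R :=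
  (deg v)%:R / M - (nonadj_pairs v)%:R / M ^+ 2
  + (nonadj_triples v)%:R / M ^+ 3.

End SimpleGraph.

(* The edges form a multiset: they are labelled by the finite type [hedge],
   and different labels may carry the same vertex set. *)
Record hypergraph := Hypergraph {
  hvertex : finType;
  hedge : finType;
  vset : hedge -> {set hvertex} }.

Section HypergraphTheory.
Variable H : hypergraph.

Definition uniform (k : nat) : Prop := forall e : hedge H, #|vset e| = k.

Definition simple (t : nat) : Prop :=
  forall e f : hedge H, e != f -> (#|vset e :&: vset f| <= t)%N.

Definition hdeg (x : hvertex H) : nat := #|[set e : hedge H | x \in vset e]|.

Definition max_hdeg : nat := \max_(x : hvertex H) hdeg x.

Definition line_adj : rel (hedge H) :=
  fun e f => (e != f) && (vset e :&: vset f != set0).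

Fact line_adj_sym : symmetric line_adj.
Proof. by move=> e f; rewrite /line_adj eq_sym setIC. Qed.

Fact line_adj_irrefl : irreflexive line_adj.
Proof. by move=> e; rewrite /line_adj eqxx. Qed.

Definition line_graph : sgraph := SGraph line_adj_sym line_adj_irrefl.

End HypergraphTheory.

(* Main.v *)
Require Import Defs.
From mathcomp Require Import all_classical all_reals all_analysis.
From mathcomp Require Import all_boot all_order all_algebra.
From mathcomp Require Import zify ring lra.
Import Order.TTheory GRing.Theory Num.Theory.
Import numFieldNormedType.Exports.

(** The inequality holds with no error term at all.  Fix an edge [e], let [d]
be its degree in the line graph, [Delta] the maximum degree of the hypergraph,
[q = 2 P] the number of ordered pairs of disjoint neighbours of [e], and [6 T]
the number of ordered triples of pairwise disjoint neighbours.  Colour every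
neighbour [f] of [e] by one vertex of [e :&: f].  There are [k] colours, and
disjoint neighbours get distinct colours, so the disjointness graph on the
neighbourhood of [e] is [k]-partite.  The proof combines two estimates.

- There are many disjoint pairs ([sqr_deg_line_graph_le]).  An intersecting
  pair either shares a vertex of [e], or has distinct colours and shares a
  vertex [w] outside [e].  If [m w] neighbours pass through [w], the second
  case gives at most [(1 - 1/k) m w ^ 2] ordered pairs at [w], because a graph
  coloured with [k] colours cannot have more edges ([multipartite_pairs]).
  Summing with [m w <= Delta] gives
  [d ^ 2 <= q + Delta * ((k - 1) * d + Delta)].

- There are few disjoint triples ([multipartite_triangles]): a [k]-partite
  graph satisfies [k (k - 1) (6 T)^2 <= (k - 2)^2 q^3], with equality for
  balanced complete [k]-partite graphs.  To see this, count the triangles at a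
  vertex [h] of degree [n h] through the edges inside its neighbourhood.
  These edges span [k - 1] colour classes, hence number at most
  [(k - 2) / (k - 1) * n h ^ 2] (as ordered pairs); they also avoid the colour
  class of [h], hence number at most [q - 2 r], where [r] is the sum of the
  degrees in that class.  The product of the two bounds controls the square of
  the number of triangles at [h], and Cauchy-Schwarz, first over the vertices
  and then over the colour classes, gives the claim.

With [M = k D], [x = d / M], [p = P / M^2] and [tau = T / M^3] this leaves a
problem in real variables ([density_optimum]).  At [x = 1] the first estimate
gives [p >= p0 = (k - 1) / (2 k^2)], and the second one at [p = p0] gives
exactly the last term of the bound.  Increasing [p] or decreasing [x] cannot
help, because the bound on [tau] grows more slowly in [p] than [p] itself and
lowering [x] by [delta] lowers the required [p] by at most [delta]. *)

Local Open Scope nat_scope.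

(** * Multipartite graphs *)

Lemma leq_sqr_sum (I : finType) (K : {set I}) (F : I -> nat) :
  (\sum_(i in K) F i) ^ 2 <= #|K| * \sum_(i in K) F i ^ 2.
Proof.
rewrite -(leq_pmul2l (isT : 0 < 2)) -mulnn big_distrlr /= big_distrr /=.
under eq_bigr => i _ do rewrite big_distrr /=.
have -> : 2 * (#|K| * \sum_(i in K) F i ^ 2)
    = \sum_(i in K) \sum_(j in K) (F i ^ 2 + F j ^ 2).
  under [RHS]eq_bigr => i _ do rewrite big_split /= sum_nat_const.
  by rewrite big_split /= sum_nat_const -big_distrr /= addnn mul2n.
by apply: leq_sum => i _; apply: leq_sum => j _; apply: nat_Cauchy.
Qed.

(** The pairs of equal colour number the sum of the squares of the class sizes,
which is least when the classes are equal. *)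
Lemma multipartite_pairs (V I : finType) (c : V -> I) (K : {set I})
    (A : {set V}) :
  {in A, forall f, c f \in K} ->
  #|K| * \sum_(f in A) \sum_(g in A) (c f != c g) <= #|K|.-1 * #|A| ^ 2.
Proof.
move=> cK; pose a i := \sum_(f in A | c f == i) 1.
have cardA : #|A| = \sum_(i in K) a i.
  by rewrite -sum1_card (partition_big c (mem K)).
have same : \sum_(f in A) \sum_(g in A) (c f == c g) = \sum_(i in K) a i ^ 2.
  rewrite (partition_big c (mem K)) //=; apply: eq_bigr => i _.
  rewrite -mulnn {1}/a big_distrl /=; apply: eq_bigr => f /andP[_ /eqP->].
  rewrite mul1n /a [RHS]big_mkcondr; apply: eq_bigr => g _.
  by rewrite eq_sym; case: eqP.
have split_pairs : #|A| ^ 2 = \sum_(f in A) \sum_(g in A) (c f == c g)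
    + \sum_(f in A) \sum_(g in A) (c f != c g).
  rewrite -big_split /= -mulnn -{1}sum1_card big_distrl /=.
  apply: eq_bigr => f _; rewrite mul1n -big_split /= -sum1_card.
  by apply: eq_bigr => g _; case: eqP.
have := leq_sqr_sum _ K a; rewrite -cardA -same.
by move: split_pairs; case: #|K| => [|m] //=; nia.
Qed.

(** Cauchy-Schwarz with weights [n], when [t h] is at most
[sqrt (b / a) * n h * sqrt (s h)].  Comparing the double sums termwise, by
[2 sqrt (s h * s g) <= s h + s g], keeps the proof within the natural
numbers. *)
Lemma weighted_Cauchy (V : finType) (a b : nat) (t n s : V -> nat) :
  (forall h, a * t h ^ 2 <= b * (n h ^ 2 * s h)) ->
  a * (\sum_h t h) ^ 2 <= b * ((\sum_h n h) * \sum_h n h * s h).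
Proof.
move=> ts; rewrite -(leq_pmul2l (isT : 0 < 2)).
have -> : 2 * (a * (\sum_h t h) ^ 2) = \sum_h \sum_g 2 * (a * (t h * t g)).
  rewrite -mulnn big_distrlr /= !big_distrr; apply: eq_bigr => h _ /=.
  by rewrite !big_distrr.
have -> : 2 * (b * ((\sum_h n h) * \sum_h n h * s h))
    = \sum_h \sum_g b * (n h * n g * (s h + s g)).
  rewrite mulnCA mul2n -addnn [X in X + _]mulnC !big_distrlr /=.
  rewrite -big_split big_distrr; apply: eq_bigr => h _ /=.
  rewrite -big_split big_distrr; apply: eq_bigr => g _ /=.
  by congr (_ * _); ring.
apply: leq_sum => h _; apply: leq_sum => g _; rewrite -leq_sqr.
have := leq_mul (ts h) (ts g).
have : 4 * (s h * s g) <= (s h + s g) ^ 2.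
  by rewrite sqrnD (mulnDl 2 2) leq_add2r nat_Cauchy.
move: (t h) (t g) (n h) (n g) (s h) (s g) => t1 t2 n1 n2 s1 s2 amgm le12.
have {amgm} := leq_mul (leqnn ((b * n1 * n2) ^ 2)) amgm.
move: le12; nia.
Qed.

Section ColouredGraph.
Variables (V I : finType) (N : rel V) (c : V -> I) (K : {set I}).
Hypotheses (Nsym : symmetric N) (cK : forall f, c f \in K).
Hypothesis cproper : forall f g, N f g -> c f != c g.

Let q := \sum_f \sum_g N f g.
Let n h := \sum_g N h g.
Let t h := \sum_g \sum_l (N h g && N h l && N g l).
Let r i := \sum_(h | c h == i) n h.

Let cardNb h : n h = #|[set g | N h g]|.
Proof.
rewrite -sum1_card big_mkcond; apply: eq_bigr => g _.
by rewrite inE; case: (N h g).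
Qed.

Let sum_r : q = \sum_(i in K) r i.
Proof. by rewrite /q (partition_big c (mem K)) // => f _; apply: cK. Qed.

(** The neighbourhood of [h] misses the colour of [h], so its edges form a
multipartite graph with one colour fewer. *)
Let t_local h : #|K|.-1 * t h <= #|K|.-2 * n h ^ 2.
Proof.
have ch : {in [set g | N h g], forall g, c g \in K :\ c h}.
  by move=> g; rewrite !inE cK andbT eq_sym => /cproper.
have := multipartite_pairs _ _ c _ _ ch.
have := cardsD1 (c h) K; rewrite cK add1n => -> /=; rewrite cardNb.
apply: leq_trans; rewrite leq_mul2l; apply/orP; right.
rewrite [leqRHS]big_mkcond /=; apply: leq_sum => g _.
rewrite inE; case: (N h g) => /=; last by rewrite big1.
rewrite [leqRHS]big_mkcond /=; apply: leq_sum => l _.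
by rewrite inE; case: (N h l) => //=; case: (boolP (N g l)) => // /cproper ->.
Qed.

(** Among the edges [g l] of the graph, those with [c g = c h], those with
[c l = c h] and those lying inside the neighbourhood of [h] form three disjoint
families, because [c] is proper. *)
Let t_global h : t h + 2 * r (c h) <= q.
Proof.
have r1 i : r i = \sum_g \sum_l ((c g == i) && N g l).
  rewrite /r big_mkcond; apply: eq_bigr => g _.
  by case: (c g == i) => //=; rewrite big1.
have r2 i : r i = \sum_g \sum_l ((c l == i) && N g l).
  rewrite r1 exchange_big /=; apply: eq_bigr => g _; apply: eq_bigr => l _.
  by rewrite Nsym.
rewrite mul2n -addnn {1}r1 r2 /t -!big_split; apply: leq_sum => g _ /=.
rewrite -!big_split; apply: leq_sum => l _ /=.
case: (boolP (N g l)) => [/cproper cgl|]; last by rewrite !andbF.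
rewrite !andbT; have [gh|gh] := eqVneq (c g) (c h).
  rewrite -gh eq_sym (negbTE cgl); case: (boolP (N h g)) => //= /cproper.
  by rewrite gh eqxx.
case: (boolP (N h g)) => //=; last by case: eqP.
by case: (boolP (N h l)) => [/cproper|] /=; rewrite eq_sym; case: eqP.
Qed.

(** The sharp triangle bound for multipartite graphs, with both sides squared to
avoid the exponent [3/2].  At each vertex [h], one of the two factors of
[t h ^ 2] is bounded by [t_local] and the other one by [t_global]. *)
Lemma multipartite_triangles :
  1 < #|K| ->
  #|K| * #|K|.-1
      * (\sum_h \sum_g \sum_l (N h g && N h l && N g l)) ^ 2
  <= #|K|.-2 ^ 2 * (\sum_f \sum_g N f g) ^ 3.
Proof.
move=> K2; rewrite -/q -[X in X ^ 2]/(\sum_h t h).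
pose s h := q - 2 * r (c h).
have Cauchy : #|K|.-1 * (\sum_h t h) ^ 2 <= #|K|.-2 * (q * \sum_h n h * s h).
  apply: weighted_Cauchy => h.
  have ts : t h <= s h by have := t_global h; rewrite /s; lia.
  by have := leq_mul (t_local h) ts; rewrite -mulnn !mulnA.
(* The vertices of colour [i] contribute [r i * (q - 2 * r i)], and the sum of
   the squares of the [r i] is at least [q ^ 2 / #|K|]. *)
have sum_ns : #|K| * \sum_h n h * s h <= #|K|.-2 * q ^ 2.
  have rr : \sum_h n h * r (c h) = \sum_(i in K) r i ^ 2.
    rewrite (partition_big c (mem K)) //=; apply: eq_bigr => i _.
    rewrite -mulnn {1}/r big_distrl /=.
    by apply: eq_bigr => h /eqP->.
  have nsr : \sum_h n h * s h + 2 * \sum_h n h * r (c h) = q ^ 2.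
    rewrite big_distrr -big_split /= -mulnn {2}/q big_distrl /=.
    apply: eq_bigr => h _; rewrite mulnCA -mulnDr /s subnK //.
    by have := t_global h; lia.
  have := leq_sqr_sum _ K r; rewrite -sum_r -rr.
  by move: nsr K2; case: #|K| => [|[|m]] //= ; nia.
have := leq_mul (leqnn #|K|) Cauchy.
have := leq_mul (leqnn (#|K|.-2 * q)) sum_ns.
by rewrite !expnS !expn0; nia.
Qed.

End ColouredGraph.

(** * Nonadjacent pairs and triples as ordered tuples *)

Section OrderedCounts.
Variables (G : sgraph) (v : G).

Definition nonadj_in_nbhd : rel G :=
  fun x y => [&& x \in nbhd v, y \in nbhd v, x != y & ~~ adj x y].

Let N := nonadj_in_nbhd.

Lemma nonadj_in_nbhd_sym : symmetric N.
Proof.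
by move=> x y; rewrite /N /nonadj_in_nbhd andbCA eq_sym adj_sym.
Qed.

Lemma leq_nonadj_pairs : \sum_x \sum_y N x y <= 2 * nonadj_pairs v.
Proof.
rewrite nonadj_pairsE; set P := [set A : {set G} | _].
have -> : 2 * #|P|
    = \sum_(A in P) \sum_x \sum_y [&& x \in A, y \in A & x != y].
  rewrite mulnC -sum_nat_const; apply: eq_bigr => A; rewrite inE.
  case/and3P=> _ /eqP A2 _.
  transitivity (\sum_(x in A) 1); first by rewrite sum1_card A2.
  rewrite big_mkcond; apply: eq_bigr => x _.
  case: ifP => xA; last by rewrite big1.
  transitivity #|A :\ x|.
    by have := cardsD1 x A; rewrite xA A2 add1n => -[<-].
  rewrite -sum1_card big_mkcond; apply: eq_bigr => y _.
  by rewrite !inE eq_sym andbC /=; case: (_ && _).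
rewrite [leqRHS]exchange_big; apply: leq_sum => x _.
rewrite [leqRHS]exchange_big; apply: leq_sum => y _ /=.
case: (boolP (N x y)) => // /and4P[xv yv xy nxy].
rewrite (bigD1 [set x; y]) /=; first by rewrite !inE !eqxx orbT xy.
rewrite inE cards2 xy subUset !sub1set xv yv /=.
apply/forall_inP => z /set2P zE; apply/forall_inP => w /set2P wE.
by case: zE wE => -> [] ->; rewrite ?eqxx ?nxy ?implybT // adj_sym nxy implybT.
Qed.

Lemma leq_nonadj_triples :
  6 * nonadj_triples v <= \sum_x \sum_y \sum_z (N x y && N x z && N y z).
Proof.
rewrite /nonadj_triples; set P := [set A : {set G} | _].
have -> : 6 * #|P| = \sum_(A in P) \sum_x \sum_y \sum_z
    [&& x \in A, y \in A :\ x & z \in A :\ x :\ y].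
  rewrite mulnC -sum_nat_const; apply: eq_bigr => A; rewrite inE.
  case/and3P=> _ /eqP A3 _.
  transitivity (\sum_(x in A) 2); first by rewrite sum_nat_const A3.
  rewrite [LHS]big_mkcond; apply: eq_bigr => x _; case: ifP => xA; last first.
    by rewrite big1 // => y _; rewrite big1.
  have A2 : #|A :\ x| = 2 by have := cardsD1 x A; rewrite xA A3 add1n => -[<-].
  transitivity (\sum_(y in A :\ x) 1); first by rewrite sum1_card A2.
  rewrite big_mkcond; apply: eq_bigr => y _.
  case: ifP => yA; last by rewrite big1.
  transitivity #|A :\ x :\ y|.
    by have := cardsD1 y (A :\ x); rewrite yA A2 add1n => -[<-].
  rewrite -sum1_card big_mkcond; apply: eq_bigr => z _ /=.
  by case: (z \in _).
rewrite [leqLHS]exchange_big; apply: leq_sum => x _.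
rewrite [leqLHS]exchange_big; apply: leq_sum => y _.
rewrite [leqLHS]exchange_big; apply: leq_sum => z _ /=.
set F := fun A : {set G} => [&& x \in A, y \in A :\ x & z \in A :\ x :\ y].
have FE A : A \in P -> F A -> (A == [set x; y; z]) && (N x y && N x z && N y z).
  rewrite inE /F !inE => /and3P[/subsetP Av /eqP A3 /forall_inP nA].
  case/and3P => xA /andP[yx yA] /and3P[zy zx zA].
  have nadj a b : a \in A -> b \in A -> b != a -> N a b.
    move=> aA bA ba; rewrite /N /nonadj_in_nbhd !Av // eq_sym ba /=.
    by have /forall_inP/(_ b bA)/implyP := nA a aA; apply; rewrite eq_sym.
  rewrite !nadj // andbT eq_sym eqEcard A3 !subUset !sub1set xA yA zA /=.
  by rewrite setUC cardsU1 cards2 !inE negb_or zx zy (eq_sym x) yx.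
have [/exists_inP[A AP FA]|noA] := boolP [exists A in P, F A]; last first.
  rewrite big1 // => A AP; apply/eqP; rewrite eqb0; apply: contra noA => FA.
  by apply/exists_inP; exists A.
have /andP[/eqP AE ->] := FE A AP FA.
rewrite (bigD1 A) //= big1 ?addn0 ?leq_b1 // => B /andP[BP BA].
apply/eqP; rewrite eqb0; apply: contra BA => FB.
by have /andP[/eqP-> _] := FE B BP FB; rewrite -AE.
Qed.

End OrderedCounts.

Lemma nonadj_pairs_le (G : sgraph) (v : G) :
  (2 * nonadj_pairs v <= deg v ^ 2)%N.
Proof.
by have := mul_bin_diag (deg v) 1; rewrite /nonadj_pairs bin1; nia.
Qed.

(** * Pairs and triples of disjoint edges in the neighbourhood of an edge *)

Section EdgeNeighbourhood.
Variables (H : hypergraph) (k : nat) (k_gt0 : 0 < k) (Hk : uniform H k).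
Variable e : line_graph H.

Let S (f : line_graph H) : {set hvertex H} := vset f.
Let Nb := nbhd e.
Let N := nonadj_in_nbhd _ e.
Let d := deg e.
Let Delta := max_hdeg H.
Let q := \sum_f \sum_g N f g.

Let cardS f : #|S f| = k. Proof. exact: Hk. Qed.

Let NE f g : N f g = [&& f \in Nb, g \in Nb & S f :&: S g == set0].
Proof.
rewrite /N /nonadj_in_nbhd /adj /= /line_adj; case: (f \in _) => //=.
case: (g \in _) => //=; have [<-|] := eqVneq f g; last by rewrite negbK.
by rewrite setIid -cards_eq0 cardS -leqn0 leqNgt k_gt0.
Qed.

(** A neighbour of [e] is coloured by one of the vertices it shares with [e]; the
colour of the other edges is an arbitrary vertex of [e]. *)
Lemma exists_colouring : exists c : line_graph H -> hvertex H,
  (forall f, c f \in S e) /\ (forall f, f \in Nb -> c f \in S f).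
Proof.
have /card_gt0P[x0 x0e] : 0 < #|S e| by rewrite cardS.
exists (fun f => odflt x0 [pick x in S e :&: S f]); split=> f.
  by case: pickP => [x /setIP[]|].
rewrite inE /adj /= => /andP[_ /set0Pn[x xef]].
by case: pickP => [y /setIP[]|/(_ x)] //=; rewrite xef.
Qed.

Let dv x := #|[set f in Nb | x \in S f]|.

Let dv_le x : dv x <= Delta.
Proof.
apply: leq_trans (leq_bigmax (F := @hdeg H) x).
by apply: subset_leq_card; apply/subsetP => f; rewrite !inE => /andP[].
Qed.

(** Both sides count incidences between [A] and the neighbours of [e]. *)
Let sum_dv (A : {set hvertex H}) :
  \sum_(x in A) dv x = \sum_(f in Nb) #|A :&: S f|.
Proof.
transitivity (\sum_(x in A) \sum_(f in Nb) (x \in S f : nat)).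
  apply: eq_bigr => x _; rewrite /dv -sum1_card big_mkcond [RHS]big_mkcond.
  by apply: eq_bigr => f _; rewrite inE; case: (f \in Nb); case: (x \in S f).
rewrite exchange_big; apply: eq_bigr => f _ /=.
rewrite -sum1_card big_mkcond [RHS]big_mkcond.
by apply: eq_bigr => x _; rewrite inE; case: (x \in A); case: (x \in S f).
Qed.

Lemma deg_line_graph_le : d <= k * Delta.
Proof.
apply: (@leq_trans (\sum_(x in S e) dv x)); last first.
  by rewrite -(cardS e) -sum_nat_const; apply: leq_sum.
rewrite sum_dv /d /deg -sum1_card; apply: leq_sum => f.
by rewrite inE /adj /= => /andP[_]; rewrite -cards_eq0 lt0n.
Qed.

Let meet := \sum_(f in Nb) \sum_(g in Nb) (S f :&: S g != set0).

Let q_meet : q + meet = d ^ 2.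
Proof.
rewrite /q /meet [X in _ + X]big_mkcond -big_split -mulnn /=.
rewrite {1}/d /deg -sum1_card big_distrl [RHS]big_mkcond /=.
apply: eq_bigr => f _; case: ifP => fNb; last first.
  by rewrite big1 // => g _; rewrite NE /Nb fNb.
rewrite mul1n [X in _ + X]big_mkcond -big_split /=.
rewrite /d /deg -sum1_card [RHS]big_mkcond /=.
apply: eq_bigr => g _; rewrite NE /Nb fNb /=.
by case: (g \in _) => //=; case: (_ == set0).
Qed.

Let mixed c x :=
  \sum_(f in [set f in Nb | x \in S f]) \sum_(g in [set f in Nb | x \in S f])
    (c f != c g :> hvertex H).

(** Two neighbours of [e] that meet without sharing a vertex of [e] have distinct
colours, since a common colour would be such a shared vertex. *)
Let meet_le c :
  (forall f, c f \in S e) -> (forall f, f \in Nb -> c f \in S f) ->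
  meet <= \sum_(x in S e) dv x ^ 2 + \sum_(x in ~: S e) mixed c x.
Proof.
move=> ce cS.
have sqE x : dv x ^ 2 = \sum_(f in Nb) \sum_(g in Nb) (x \in S f :&: S g).
  rewrite -mulnn {1}/dv -sum1_card big_distrl /= big_mkcond [RHS]big_mkcond.
  apply: eq_bigr => f _; rewrite inE; case: (f \in Nb) => //=.
  case: ifP => xf; last by rewrite big1 // => g _; rewrite inE xf.
  rewrite mul1n /dv -sum1_card big_mkcond [RHS]big_mkcond.
  apply: eq_bigr => g _; rewrite in_setI in_set xf.
  by case: (g \in Nb); case: (x \in S g).
have mixE x : mixed c x
    = \sum_(f in Nb) \sum_(g in Nb) ((x \in S f :&: S g) && (c f != c g)).
  rewrite /mixed big_mkcond [RHS]big_mkcond.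
  apply: eq_bigr => f _; rewrite inE; case: (f \in Nb) => //=.
  case: ifP => xf; last by rewrite big1 // => g _; rewrite inE xf.
  rewrite big_mkcond [RHS]big_mkcond.
  apply: eq_bigr => g _; rewrite in_setI in_set xf.
  by case: (g \in Nb); case: (x \in S g).
under eq_bigr => x _ do rewrite sqE.
under [X in _ <= _ + X]eq_bigr => x _ do rewrite mixE.
rewrite exchange_big [X in _ <= _ + X]exchange_big -big_split /=.
apply: leq_sum => f fNb.
rewrite exchange_big [X in _ <= _ + X]exchange_big -big_split /=.
apply: leq_sum => g gNb.
have [//|/set0Pn[x xfg]] := eqVneq.
have [/exists_inP[y ye yfg]|noy] := boolP [exists y in S e, y \in S f :&: S g].
  by rewrite (bigD1 y) //= [y \in _]yfg.
rewrite (bigD1 x (P := mem (~: S e))) /=.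
  rewrite xfg addnCA [X in _ <= X]/=.
  have [cfg|//] := eqVneq (c f) (c g).
  case/negP: noy; apply/exists_inP; exists (c f); first exact: ce.
  by rewrite inE /= cS // cfg cS.
by rewrite inE; apply/negP => xe; case/negP: noy; apply/exists_inP; exists x.
Qed.

(** A neighbour meeting [e] in [s] vertices contributes to the intersecting pairs
at most [Delta] for each of these [s] vertices and [(1 - 1/k) * Delta] for each
of its [k - s] other vertices, that is [(k - 1 + s / k) * Delta]; and the sum
of all [s] is at most [k * Delta].  Keeping the sum of [s], instead of
estimating it by [d], is what allows neighbours that meet [e] in several
vertices. *)
Lemma sqr_deg_line_graph_le : d ^ 2 <= q + Delta * (k.-1 * d + Delta).
Proof.
have [c [ce cS]] := exists_colouring.
rewrite -q_meet leq_add2l -(leq_pmul2l k_gt0).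
apply: leq_trans (leq_mul (leqnn k) (meet_le _ ce cS)) _.
have -> : k * (Delta * (k.-1 * d + Delta))
    = k.-1 * (k * d * Delta) + Delta * (k * Delta) by ring.
have in_e : \sum_(x in S e) dv x ^ 2 <= Delta * \sum_(x in S e) dv x.
  rewrite big_distrr; apply: leq_sum => x _.
  by rewrite -mulnn leq_mul2r dv_le orbT.
have out_e : k * \sum_(x in ~: S e) mixed c x
    <= k.-1 * (Delta * \sum_(x in ~: S e) dv x).
  rewrite !big_distrr; apply: leq_sum => x _.
  have := multipartite_pairs _ _ c (S e) [set f in Nb | x \in S f]
            (fun f _ => ce f).
  rewrite cardS => /leq_trans; apply.
  by rewrite leq_mul2l -mulnn leq_mul2r dv_le !orbT.
have total : \sum_(x in S e) dv x + \sum_(x in ~: S e) dv x = k * d.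
  rewrite !sum_dv -big_split /d /deg mulnC -sum_nat_const.
  apply: eq_bigr => f _.
  rewrite /= -(cardS f) -[in RHS](cardsID (S e) (S f)) setIC; congr (_ + #|_|).
  by rewrite setDE setIC.
have sum_e : \sum_(x in S e) dv x <= k * Delta.
  by rewrite -(cardS e) -sum_nat_const; apply: leq_sum.
move: in_e out_e total sum_e k_gt0.
case: k => [|m] //=; nia.
Qed.

Let N_proper c : (forall f, f \in Nb -> c f \in S f) ->
  forall f g, N f g -> c f != c g :> hvertex H.
Proof.
move=> cS f g; rewrite NE => /and3P[fN gN]; apply: contraL => /eqP cfg.
by apply/set0Pn; exists (c f); rewrite inE cS // cfg cS.
Qed.

Lemma nonadj_triples_line_graph :
  k * k.-1 * (6 * nonadj_triples e) ^ 2
  <= k.-2 ^ 2 * (2 * nonadj_pairs e) ^ 3.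
Proof.
have [c [ce cS]] := exists_colouring.
have [k1|k2] := leqP k 1; first by move: k_gt0 k1; case: k => [|[|m]] //; lia.
have := @multipartite_triangles _ _ N c (S e) (nonadj_in_nbhd_sym _ e) ce
          (N_proper _ cS).
rewrite cardS => /(_ k2); rewrite -/q => tri.
have T6 := leq_nonadj_triples _ e; have P2 := leq_nonadj_pairs _ e.
apply: leq_trans (leq_trans _ tri) _.
- by rewrite leq_mul2l leq_sqr T6 orbT.
- by rewrite leq_mul2l leq_exp2r // P2 orbT.
Qed.

(** When [k = 1], [nonadj_triples_line_graph] says nothing, but all neighbours of
[e] contain its only vertex. *)
Lemma nonadj_triples_rank1 : k = 1 -> nonadj_triples e = 0.
Proof.
have [c [ce cS]] := exists_colouring => k1.
have /eqP/cards1P[x0 Sx0] : #|S e| = 1 by rewrite cardS.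
apply/eqP; rewrite -leqn0 -(leq_pmul2l (isT : 0 < 6)) muln0.
apply: leq_trans (leq_nonadj_triples _ e) _.
rewrite leqn0 big1 // => f _; rewrite big1 // => g _; rewrite big1 // => h _.
case: (boolP (nonadj_in_nbhd _ _ f g)) => // /(N_proper _ cS).
by have := ce f; have := ce g; rewrite Sx0 !inE => /eqP-> /eqP->; rewrite eqxx.
Qed.

End EdgeNeighbourhood.

(** * The optimization over densities *)

Local Open Scope ring_scope.

(** In terms of [s = sqrt (2 p)] and [s0 = sqrt (k - 1) / k], the last hypothesis
says [6 tau <= kappa * s^3] for a constant [kappa <= 1], and the last term of
the bound is [kappa * s0^3 / 6].  If [s <= s0], then [tau] is at most this
term, and the loss [s0^2 / 2 - p] is at most [1 - x] by the quadratic
hypothesis.  If [s0 < s <= 1], then going from [s0] to [s] raises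
[kappa * s^3 / 6] by no more than it raises [p = s^2 / 2]. *)
Lemma density_optimum (R : rcfType) (k x p tau : R) :
  2 <= k -> x <= 1 -> 0 <= p -> p <= 1 / 2 -> 0 <= tau ->
  x ^+ 2 <= 2 * p + (k - 1) / k * x + 1 / k ^+ 2 ->
  k * (k - 1) * (6 * tau) ^+ 2 <= (k - 2) ^+ 2 * (2 * p) ^+ 3 ->
  x - p + tau <=
    1 - (k - 1) / (2 * k ^+ 2)
    + (k - 1) * (k - 2) / (6 * k ^+ 3 * Num.sqrt k).
Proof.
move=> k2 x1 p0 p1 tau0 xp ptau.
pose a := Num.sqrt k; pose b := Num.sqrt (k - 1); pose s := Num.sqrt (2 * p).
have a2 : a ^+ 2 = k by rewrite sqr_sqrtr //; lra.
have b2 : b ^+ 2 = k - 1 by rewrite sqr_sqrtr //; lra.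
have s2 : s ^+ 2 = 2 * p by rewrite sqr_sqrtr //; lra.
have a_gt0 : 0 < a by rewrite sqrtr_gt0; lra.
have b_gt0 : 0 < b by rewrite sqrtr_gt0; lra.
have s_ge0 : 0 <= s by rewrite sqrtr_ge0.
have s1 : s <= 1 by rewrite -(@ler_pXn2r _ 2) ?nnegrE // s2; lra.
have ab_gt0 : 0 < a * b by rewrite mulr_gt0.
pose kappa := (k - 2) / (a * b); pose s0 := b / a ^+ 2.
have k2_ge0 : 0 <= k - 2 by lra.
have ab_ge0 : 0 <= a * b by exact: ltW.
have kappa_ge0 : 0 <= kappa by rewrite divr_ge0.
have kappa1 : kappa <= 1.
  rewrite ler_pdivrMr // mul1r -(@ler_pXn2r _ 2) ?nnegrE //.
  by rewrite exprMn a2 b2; nra.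
have s0_gt0 : 0 < s0 by rewrite divr_gt0 // exprn_gt0.
have tau_le : 6 * tau <= kappa * s ^+ 3.
  rewrite /kappa mulrAC ler_pdivlMr //.
  rewrite -(@ler_pXn2r _ 2) ?nnegrE //; last 2 first.
  - by apply: mulr_ge0 => //; lra.
  - by apply: mulr_ge0 => //; apply: exprn_ge0.
  by move: ptau; rewrite !exprMn a2 b2 s2; lra.
have -> : (k - 1) / (2 * k ^+ 2) = s0 ^+ 2 / 2.
  by rewrite /s0 -b2 -a2; field; rewrite gt_eqF.
have -> : (k - 1) * (k - 2) / (6 * k ^+ 3 * Num.sqrt k) = kappa * s0 ^+ 3 / 6.
  rewrite -/a /kappa /s0 -b2 -[k]a2.
  by field; rewrite !gt_eqF.
have pE : p = s ^+ 2 / 2 by rewrite s2; lra.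
have [ss0|s0s] := leP s s0.
  have cube : s ^+ 3 <= s0 ^+ 3 by rewrite lerXn2r ?nnegrE // ltW.
  have := ler_wpM2l kappa_ge0 cube.
  suff : s0 ^+ 2 / 2 - p <= 1 - x by lra.
  (* With [u] the inverse of [k], the claim becomes
     [0 <= (1 - x) * (2 - x - u)]. *)
  have -> : s0 ^+ 2 = k^-1 - k^-1 ^+ 2.
    rewrite /s0 expr_div_n b2 a2; field; lra.
  have u1 : k^-1 <= 1 by rewrite invf_le1; lra.
  move: xp; have -> : (k - 1) / k = 1 - k^-1 by field; lra.
  rewrite div1r -exprVn; nra.
suff : kappa * (s ^+ 3 - s0 ^+ 3) <= 3 * (s ^+ 2 - s0 ^+ 2) by lra.
apply: (@le_trans _ _ (s ^+ 3 - s0 ^+ 3)).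
  by rewrite ler_piMl // subr_ge0 lerXn2r ?nnegrE // ltW.
suff : 0 <= (s - s0) * (3 * (s + s0) - (s ^+ 2 + s * s0 + s0 ^+ 2)) by lra.
by apply: mulr_ge0; [lra | nra].
Qed.

Local Open Scope classical_set_scope.
Local Open Scope ring_scope.

Theorem lemma3p4 (R : realType) (k : nat) (hk : (0 < k)%N) :
  exists err : R -> R,
    err x @[x --> +oo] --> (0 : R) /\
    forall (D : R) (H : hypergraph),
      uniform H k -> simple H k -> (max_hdeg H)%:R <= D ->
      forall e : line_graph H,
        bfun (k%:R * D) e <=
          1 - (k%:R - 1) / (2 * k%:R ^+ 2)
          + (k%:R - 1) * (k%:R - 2) / (6 * k%:R ^+ 3 * Num.sqrt k%:R)
          + err D.
Proof.
exists (fun=> 0); split; first exact: cvg_cst.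
move=> D H Hk _ DD e; rewrite addr0.
have d_le := deg_line_graph_le H k Hk e.
have sqd_le := sqr_deg_line_graph_le H k hk Hk e.
have T_le := nonadj_triples_line_graph H k hk Hk e.
have P_ge := leq_nonadj_pairs _ e.
have P_le := nonadj_pairs_le _ e.
have T1 := nonadj_triples_rank1 H k hk Hk e.
(* The vertices of [e] have positive degree, so [D > 0]. *)
have Delta_gt0 : (0 < max_hdeg H)%N.
  have /card_gt0P[v ve] : (0 < #|vset (e : hedge H)|)%N by rewrite Hk.
  apply: leq_trans (leq_bigmax (F := @hdeg H) v).
  by apply/card_gt0P; exists (e : hedge H); rewrite inE.
rewrite /bfun; move: (deg e) (nonadj_pairs e) (nonadj_triples e) (max_hdeg H)
  d_le sqd_le T_le P_ge P_le T1 Delta_gt0 DD => d P T Delta.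
move=> d_le sqd_le T_le P_ge P_le T1 Delta_gt0 DD.
have {P_ge}sqd_le : (d ^ 2 <= 2 * P + Delta * (k.-1 * d + Delta))%N.
  by apply: leq_trans sqd_le _; rewrite leq_add2r.
have k_gt0 : 0 < k%:R :> R by rewrite ltr0n.
have Delta0 : 0 < Delta%:R :> R by rewrite ltr0n.
have D_gt0 : 0 < D by apply: lt_le_trans DD.
have M_gt0 : 0 < k%:R * D by rewrite mulr_gt0.
have dM : d%:R <= k%:R * D.
  apply: le_trans (_ : (k * Delta)%:R <= _); first by rewrite ler_nat.
  by rewrite natrM ler_pM2l.
set x := d%:R / _; set p := P%:R / _; set tau := T%:R / _.
have x1 : x <= 1 by rewrite ler_pdivrMr // mul1r.
have x0 : 0 <= x by rewrite divr_ge0 // ltW.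
have p0 : 0 <= p by rewrite divr_ge0 // exprn_ge0 // ltW.
have tau0 : 0 <= tau by rewrite divr_ge0 // exprn_ge0 // ltW.
have [k1|k2] := leqP k 1.
  have {}k1 : k = 1%N by apply/eqP; rewrite eqn_leq k1.
  by rewrite /tau T1 // k1 subrr !mul0r; lra.
have p1 : p <= 1 / 2.
  have : 2 * p <= x ^+ 2.
    rewrite /p /x expr_div_n mulrA ler_pM2r ?invr_gt0 ?exprn_gt0 //.
    by rewrite -natrX -natrM ler_nat.
  have : x ^+ 2 <= 1 by rewrite expr_le1.
  lra.
apply: density_optimum => //.
- by rewrite ler_nat.
- have : d%:R ^+ 2 <= 2 * P%:R + D * ((k%:R - 1) * d%:R + D) :> R.
    apply: le_trans (_ : (2 * P + Delta * (k.-1 * d + Delta))%:R <= _).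
      by rewrite -natrX ler_nat.
    rewrite !(natrD, natrM) lerD2l -subn1 natrB //.
    apply: ler_pM => //; last by rewrite lerD2l.
    by apply: addr_ge0 => //; apply: mulr_ge0 => //; rewrite subr_ge0 ler1n.
  rewrite -(@ler_pM2r _ ((k%:R * D) ^- 2)) ?invr_gt0 ?exprn_gt0 //.
  rewrite -expr_div_n -/x => /le_trans; apply.
  rewrite le_eqVlt; apply/orP; left.
  apply/eqP; rewrite /x /p; field; by rewrite !gt_eqF.
have : k%:R * (k%:R - 1) * (6 * T%:R) ^+ 2
    <= (k%:R - 2) ^+ 2 * (2 * P%:R) ^+ 3 :> R.
  move: T_le; rewrite -(ler_nat R) !(natrM, natrX) -subn2 -subn1 !natrB //.
rewrite -(@ler_pM2r _ ((k%:R * D) ^- 6)) ?invr_gt0 ?exprn_gt0 //.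
congr (_ <= _); rewrite /p /tau; field; by rewrite !gt_eqF.
Qed.
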